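(* Let $M(f_1,\ldots,f_6)$ be a generalized $(\kappa,\mu)$-space form. Then, for all vector fields $X,Y,Z,W$ orthogonal to $\xi$, $$R(X,Y,Z,\phi W)+R(X,Y,\phi Z,W)=-(f_1-f_2)P(X,Y,Z,W)-f_4\big(P(hX,Y,Z,W)+P(X,hY,Z,W)\big)-2f_5P(hX,hY,Z,W).$$
   Context: All functions and tensors are smooth. An almost contact metric manifold $(M,\phi,\xi,\eta,g)$ is an odd-dimensional Riemannian manifold $(M,g)$ with a $(1,1)$-tensor field $\phi$, a vector field $\xi$ and a 1-form $\eta$ with $\eta(\xi)=1$, $\phi^2X=-X+\eta(X)\xi$, $g(\phi X,\phi Y)=g(X,Y)-\eta(X)\eta(Y)$. Put $h=\tfrac12 L_\xi\phi$ ($L$ the Lie derivative). The curvature is $R(X,Y)Z=\nabla_X\nabla_YZ-\nabla_Y\nabla_XZ-\nabla_{[X,Y]}Z$ and $R(X,Y,Z,W)=g(R(X,Y)Z,W)$. Define $P(X,Y,Z,W)=g(X,\phi Z)g(Y,W)-g(X,\phi W)g(Y,Z)-g(Y,\phi Z)g(X,W)+g(Y,\phi W)g(X,Z)$. An almost contact metric manifold is a generalized $(\kappa,\mu)$-space form, denoted $M(f_1,\ldots,f_6)$, if there are functions $f_1,\ldots,f_6$ on $M$ with $R=\sum_{i=1}^6 f_iR_i$, where $R_1(X,Y)Z=g(Y,Z)X-g(X,Z)Y$; $R_2(X,Y)Z=g(X,\phi Z)\phi Y-g(Y,\phi Z)\phi X+2g(X,\phi Y)\phi Z$; $R_3(X,Y)Z=\eta(X)\eta(Z)Y-\eta(Y)\eta(Z)X+g(X,Z)\eta(Y)\xi-g(Y,Z)\eta(X)\xi$;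 $R_4(X,Y)Z=g(Y,Z)hX-g(X,Z)hY+g(hY,Z)X-g(hX,Z)Y$; $R_5(X,Y)Z=g(hY,Z)hX-g(hX,Z)hY+g(\phi hX,Z)\phi hY-g(\phi hY,Z)\phi hX$; $R_6(X,Y)Z=\eta(X)\eta(Z)hY-\eta(Y)\eta(Z)hX+g(hX,Z)\eta(Y)\xi-g(hY,Z)\eta(X)\xi$. *)

(* Defs.v *)
From HB Require Import structures.
From mathcomp Require Import all_boot all_order all_algebra.
From mathcomp Require Import boolp classical_sets functions reals topology.
From mathcomp Require Import normedtype derive.
From mathcomp Require Import ring.

Set Implicit Arguments.
Unset Strict Implicit.
Unset Printing Implicit Defensive.

Import Order.TTheory GRing.Theory Num.Theory.
Import numFieldNormedType.Exports.

Local Open Scope classical_set_scope.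
Local Open Scope ring_scope.

(** * Functions of class C^k on an open subset of R^n *)

Section Euclidean.
Context {R : realType} {n : nat}.
Implicit Types (U : set 'rV[R]_n) (f g : 'rV[R]_n -> R).

Fixpoint Ck (k : nat) U f : Prop :=
  (forall x, U x -> {for x, continuous f}) /\
  if k is k'.+1 then
    forall i : 'I_n,
      (forall x, U x -> derivable f x (delta_mx 0 i)) /\
      Ck k' U ('D_(delta_mx 0 i) f)
  else True.

Definition smooth_on U f := forall k, Ck k U f.

Lemma Ck_continuous k U f : Ck k U f -> forall x, U x -> {for x, continuous f}.
Proof. by case: k => [|k] []. Qed.

Lemma CkS k U f : Ck k.+1 U f -> Ck k U f.
Proof.
elim: k f => [|k IH] f [cf df]; first by split.
by split=> // i; have [di /IH] := df i.
Qed.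

Lemma eq_Ck k U f g : open U -> (forall x, U x -> f x = g x) ->
  Ck k U f -> Ck k U g.
Proof.
move=> oU.
have nfg (u v : 'rV[R]_n -> R) : (forall x, U x -> u x = v x) ->
    forall x, U x -> \near x, u x = v x.
  by move=> uv x Ux; exact: filterS uv (open_nbhs_nbhs (conj oU Ux)).
have cfg (u v : 'rV[R]_n -> R) : (forall x, U x -> u x = v x) ->
    (forall x, U x -> {for x, continuous u}) ->
    forall x, U x -> {for x, continuous v}.
  move=> uv cu x Ux; rewrite /prop_for /continuous_at -(uv x Ux).
  exact: cvg_trans (near_eq_cvg (nfg _ _ uv x Ux)) (cu x Ux).
elim: k f g => [|k IH] f g fg [cf df]; first by split=> //; exact: cfg cf.
split=> [|i]; first exact: cfg cf.
have [di ki] := df i; split=> [x Ux|].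
  exact: near_eq_derivable (nfg _ _ fg x Ux) (di x Ux).
by apply: (IH _ _ _ ki) => x Ux; exact: near_eq_derive (nfg _ _ fg x Ux).
Qed.

Lemma Ck_cst k U (c : R) : Ck k U (cst c).
Proof.
have cc (d : R) x : U x -> {for x, continuous (cst d : 'rV[R]_n -> R)}.
  by move=> _; exact: cst_continuous.
elim: k c => [|k IH] c; split; [exact: cc|by []|exact: cc|].
move=> i; split=> [x _|]; first exact: derivable_cst.
suff -> : 'D_(delta_mx 0 i) (cst c : 'rV[R]_n -> R) = cst 0 by [].
by apply/funext => x; rewrite derive_cst.
Qed.

Lemma CkD k U f g : open U -> Ck k U f -> Ck k U g -> Ck k U (f + g).
Proof.
move=> oU; elim: k f g => [|k IH] f g [cf df] [cg dg].
  by split=> // x Ux; exact: continuousD (cf x Ux) (cg x Ux).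
split=> [x Ux|i]; first exact: continuousD (cf x Ux) (cg x Ux).
have [[fi kf] [gi kg]] := (df i, dg i); split=> [x Ux|].
  exact: derivableD (fi x Ux) (gi x Ux).
apply: eq_Ck (IH _ _ kf kg) => // x Ux.
by rewrite (deriveD (fi x Ux) (gi x Ux)).
Qed.

Lemma CkM k U f g : open U -> Ck k U f -> Ck k U g -> Ck k U (f * g).
Proof.
move=> oU; elim: k f g => [|k IH] f g.
  by move=> [cf df] [cg dg]; split=> // x Ux; exact: continuousM (cf x Ux) (cg x Ux).
move=> hf hg; have [[cf df] [cg dg]] := (hf, hg).
split=> [x Ux|i]; first exact: continuousM (cf x Ux) (cg x Ux).
have [[fi kf] [gi kg]] := (df i, dg i); split=> [x Ux|].
  exact: derivableM (fi x Ux) (gi x Ux).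
apply: eq_Ck (CkD oU (IH _ _ (CkS hf) kg) (IH _ _ (CkS hg) kf)) => // x Ux.
by rewrite (deriveM (fi x Ux) (gi x Ux)).
Qed.

End Euclidean.

(** * Smooth manifolds *)

(* [cinv] is only meaningful on the open set [cmap @` cdom] *)
Record chart (R : realType) (n : nat) (T : topologicalType) := Chart {
  cdom : set T;
  cmap : T -> 'rV[R]_n;
  cinv : 'rV[R]_n -> T;
  open_cdom : open cdom;
  open_ccodom : open (cmap @` cdom);
  cmapK : forall x, cdom x -> cinv (cmap x) = x;
  continuous_cmap : {within cdom, continuous cmap};
  continuous_cinv : {within cmap @` cdom, continuous cinv} }.

Definition compatible_charts (R : realType) n (T : topologicalType)
    (c d : chart R n T) :=
  forall j : 'I_n, smooth_on (cmap c @` (cdom c `&` cdom d))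
    (fun x => cmap d (cinv c x) 0 j).

(* The atlas need not be maximal: it generates the same smooth functions as the
   maximal atlas containing it. *)
Record manifold (R : realType) (n : nat) := Manifold {
  carrier :> topologicalType;
  atlas : set (chart R n carrier);
  manifold_hausdorff : hausdorff_space carrier;
  manifold_second_countable : @second_countable carrier;
  atlas_cover : forall p : carrier, exists2 c, atlas c & cdom c p;
  atlas_compatible : forall c d, atlas c -> atlas d -> compatible_charts c d }.

Section SmoothFunctions.
Context {R : realType} {n : nat} (M : manifold R n).

Definition is_smooth (f : M -> R) := forall c, atlas c ->
  smooth_on (cmap c @` cdom c) (f \o cinv c).

Definition smooth_pred : {pred M -> R} := mem [set f | is_smooth f].

Record smooth_fun := SmoothFun {
  smooth_val :> M -> R;
  _ : smooth_val \in smooth_pred }.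

HB.instance Definition _ := [isSub for smooth_val].
HB.instance Definition _ := [Choice of smooth_fun by <:].

Lemma smooth_fun_ext (f g : smooth_fun) : (forall p, f p = g p) -> f = g.
Proof. by move=> fg; apply/val_inj/funext. Qed.

Lemma is_smooth_cst (c : R) : is_smooth (cst c).
Proof. by move=> d _ k; exact: Ck_cst. Qed.

Lemma is_smoothD f g : is_smooth f -> is_smooth g -> is_smooth (f + g).
Proof.
by move=> sf sg d ad k; apply: CkD; [exact: open_ccodom|exact: sf|exact: sg].
Qed.

Lemma is_smoothM f g : is_smooth f -> is_smooth g -> is_smooth (f * g).
Proof.
by move=> sf sg d ad k; apply: CkM; [exact: open_ccodom|exact: sf|exact: sg].
Qed.

Lemma is_smoothZ (c : R) f : is_smooth f -> is_smooth (c *: (f : M -> R^o)).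
Proof. exact/is_smoothM/is_smooth_cst. Qed.

Lemma smooth_subring_closed : subring_closed smooth_pred.
Proof.
split=> [|f g|f g]; rewrite !inE /=; first exact: is_smooth_cst.
- move=> sf sg; apply: is_smoothD => //.
  suff -> : - g = -1 *: (g : M -> R^o) by exact: is_smoothZ.
  by rewrite scaleN1r.
- exact: is_smoothM.
Qed.

HB.instance Definition _ := GRing.SubChoice_isSubComPzRing.Build
  (M -> R) smooth_pred smooth_fun smooth_subring_closed.

Definition smooth_cst (c : R) : smooth_fun :=
  SmoothFun (mem_set (is_smooth_cst c)).

Let scale (c : R) (f : smooth_fun) := smooth_cst c * f.

Let scaleA a b f : scale a (scale b f) = scale (a * b) f.
Proof. by apply: smooth_fun_ext => p; exact: mulrA. Qed.

Let scale1 : left_id 1 scale.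
Proof. by move=> f; apply: smooth_fun_ext => p; exact: mul1r. Qed.

Let scaleDr : right_distributive scale +%R.
Proof. by move=> a f g; apply: smooth_fun_ext => p; exact: mulrDr. Qed.

Let scaleDl f : {morph scale^~ f : a b / a + b}.
Proof. by move=> a b; apply: smooth_fun_ext => p; exact: mulrDl. Qed.

HB.instance Definition _ := GRing.Zmodule_isLmodule.Build R smooth_fun
  scaleA scale1 scaleDr scaleDl.

Lemma smooth_scaleE (c : R) (f : smooth_fun) : c *: f = smooth_cst c * f.
Proof. by []. Qed.

End SmoothFunctions.

Notation "'C^oo' ( M )" := (smooth_fun M)
  (at level 8, format "'C^oo' ( M )") : type_scope.

(** * Vector fields

   A vector field is a derivation of the algebra of smooth functions; its
   tangent vector at [p] is the point derivation [f |-> X f p]. *)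

Section VectorFields.
Context {R : realType} {n : nat} (M : manifold R n).

Record vfield := VField {
  vfield_fun :> C^oo(M) -> C^oo(M);
  vfield_linear : linear vfield_fun;
  vfield_leibniz : forall f g,
    vfield_fun (f * g) = f * vfield_fun g + g * vfield_fun f }.

HB.instance Definition _ := gen_eqMixin vfield.
HB.instance Definition _ := gen_choiceMixin vfield.

Implicit Types (X Y Z : vfield) (f g : C^oo(M)).

Lemma vfield_ext X Y : (forall f, X f = Y f) -> X = Y.
Proof.
case: X Y => [X lX dX] [Y lY dY] /= /funext XY; subst Y.
by congr VField; exact: Prop_irrelevance.
Qed.

Lemma vfieldD X f g : X (f + g) = X f + X g.
Proof. by have := vfield_linear X 1 f g; rewrite !scale1r. Qed.

Lemma vfieldB X f g : X (f - g) = X f - X g.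
Proof.
by have := vfield_linear X (-1) g f; rewrite !scaleN1r ![- _ + _]addrC.
Qed.

Fact vzero_linear : linear (fun _ : C^oo(M) => 0 : C^oo(M)).
Proof. by move=> a f g; rewrite scaler0 addr0. Qed.

Fact vzero_leibniz f g : 0 = f * 0 + g * 0 :> C^oo(M).
Proof. by rewrite !mulr0 addr0. Qed.

Definition vzero := VField vzero_linear vzero_leibniz.

Fact vadd_linear X Y : linear (fun f => X f + Y f).
Proof. by move=> a f g; rewrite !vfield_linear scalerDr addrACA. Qed.

Fact vadd_leibniz X Y f g :
  X (f * g) + Y (f * g) = f * (X g + Y g) + g * (X f + Y f).
Proof. by rewrite !vfield_leibniz !mulrDr addrACA. Qed.

Definition vadd X Y := VField (vadd_linear X Y) (@vadd_leibniz X Y).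

Fact vopp_linear X : linear (fun f => - X f).
Proof. by move=> a f g; rewrite vfield_linear opprD scalerN. Qed.

Fact vopp_leibniz X f g : - X (f * g) = f * - X g + g * - X f.
Proof. by rewrite vfield_leibniz !mulrN opprD. Qed.

Definition vopp X := VField (vopp_linear X) (@vopp_leibniz X).

Fact vscale_linear h X : linear (fun f => h * X f).
Proof. by move=> a f g; rewrite vfield_linear mulrDr !smooth_scaleE mulrCA. Qed.

Fact vscale_leibniz h X f g : h * X (f * g) = f * (h * X g) + g * (h * X f).
Proof. by rewrite vfield_leibniz mulrDr; congr (_ + _); exact: mulrCA. Qed.

Definition vscale h X := VField (vscale_linear h X) (@vscale_leibniz h X).

Let vaddA : associative vadd.
Proof. by move=> X Y Z; apply: vfield_ext => f; exact: addrA. Qed.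

Let vaddC : commutative vadd.
Proof. by move=> X Y; apply: vfield_ext => f; exact: addrC. Qed.

Let vadd0 : left_id vzero vadd.
Proof. by move=> X; apply: vfield_ext => f; exact: add0r. Qed.

Let vaddN : left_inverse vzero vopp vadd.
Proof. by move=> X; apply: vfield_ext => f; exact: addNr. Qed.

HB.instance Definition _ := GRing.isZmodule.Build vfield vaddA vaddC vadd0 vaddN.

Let vscaleA f g X : vscale f (vscale g X) = vscale (f * g) X.
Proof. by apply: vfield_ext => u; exact: mulrA. Qed.

Let vscale1 : left_id 1 vscale.
Proof. by move=> X; apply: vfield_ext => u; exact: mul1r. Qed.

Let vscaleDr : right_distributive vscale +%R.
Proof. by move=> f X Y; apply: vfield_ext => u; exact: mulrDr. Qed.

Let vscaleDl X : {morph vscale^~ X : f g / f + g}.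
Proof. by move=> f g; apply: vfield_ext => u; exact: mulrDl. Qed.

HB.instance Definition _ := GRing.Zmodule_isLmodule.Build C^oo(M) vfield
  vscaleA vscale1 vscaleDr vscaleDl.

Fact bracket_linear X Y : linear (fun f => X (Y f) - Y (X f)).
Proof.
by move=> a f g; rewrite !vfield_linear opprD addrACA scalerBr.
Qed.

Fact bracket_leibniz X Y f g : X (Y (f * g)) - Y (X (f * g)) =
  f * (X (Y g) - Y (X g)) + g * (X (Y f) - Y (X f)).
Proof.
rewrite !vfield_leibniz !vfieldD !vfield_leibniz; ring.
Qed.

Definition bracket X Y := VField (bracket_linear X Y) (@bracket_leibniz X Y).

End VectorFields.

(** * Tensors and the Levi-Civita connection *)

Section Riemannian.
Context {R : realType} {n : nat} {M : manifold R n}.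
Implicit Types (X Y Z : vfield M) (f : C^oo(M)).

(* Tensor fields are C^oo(M)-multilinear maps; [{linear vfield M -> vfield M}]
   is the type of (1,1)-tensor fields and [{scalar vfield M}] that of 1-forms. *)
Record riemannian_metric := RiemannianMetric {
  riem :> vfield M -> vfield M -> C^oo(M);
  riem_linear : forall Y : vfield M, scalar (riem^~ Y);
  riem_sym : forall X Y : vfield M, riem X Y = riem Y X;
  riem_ge0 : forall (X : vfield M) (p : M), 0 <= riem X X p;
  riem_definite : forall (X : vfield M) (p : M), riem X X p = 0 ->
    forall f, X f p = 0 }.

(* L_Z is the derivation of the tensor algebra with L_Z X = [Z, X]. *)
Definition lie_derivative (Z : vfield M) (T : vfield M -> vfield M) X :=
  bracket Z (T X) - T (bracket Z X).

Record levi_civita (g : riemannian_metric)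
    (nabla : vfield M -> vfield M -> vfield M) : Prop := LeviCivita {
  nabla_linear : forall Y : vfield M, linear (nabla^~ Y);
  nabla_additive : forall X Y Z : vfield M,
    nabla X (Y + Z) = nabla X Y + nabla X Z;
  nabla_leibniz : forall (X : vfield M) (f : C^oo(M)) (Y : vfield M),
    nabla X (f *: Y) = X f *: Y + f *: nabla X Y;
  nabla_torsion_free : forall X Y : vfield M, nabla X Y - nabla Y X = bracket X Y;
  nabla_compatible : forall X Y Z : vfield M,
    X (g Y Z) = g (nabla X Y) Z + g Y (nabla X Z) }.

Definition curvature (nabla : vfield M -> vfield M -> vfield M) X Y Z :=
  nabla X (nabla Y Z) - nabla Y (nabla X Z) - nabla (bracket X Y) Z.

Definition curvature4 (g : riemannian_metric)
    (nabla : vfield M -> vfield M -> vfield M) X Y Z W :=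
  g (curvature nabla X Y Z) W.

End Riemannian.

Arguments riemannian_metric {R n} M.

Record almost_contact_metric (R : realType) (n : nat) (M : manifold R n) :=
  AlmostContactMetric {
  acm_g :> riemannian_metric M;
  acm_phi : {linear vfield M -> vfield M};
  acm_xi : vfield M;
  acm_eta : {scalar vfield M};
  acm_dim_odd : odd n;
  acm_eta_xi : acm_eta acm_xi = 1;
  acm_phi2 : forall X : vfield M, acm_phi (acm_phi X) = - X + acm_eta X *: acm_xi;
  acm_compatible : forall X Y : vfield M,
    acm_g (acm_phi X) (acm_phi Y) = acm_g X Y - acm_eta X * acm_eta Y }.

(** * Generalized (kappa, mu)-space forms *)

Section SpaceForms.
Context {R : realType} {n : nat} {M : manifold R n}.
Variable S : almost_contact_metric M.
Implicit Types X Y Z W : vfield M.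

Let g := acm_g S.
Let phi := acm_phi S.
Let xi := acm_xi S.
Let eta := acm_eta S.

Definition acm_h X : vfield M :=
  smooth_cst M 2^-1 *: lie_derivative xi phi X.

Let h := acm_h.

Definition acm_P X Y Z W : C^oo(M) :=
  g X (phi Z) * g Y W - g X (phi W) * g Y Z
  - g Y (phi Z) * g X W + g Y (phi W) * g X Z.

Definition acm_R1 X Y Z := g Y Z *: X - g X Z *: Y.

Definition acm_R2 X Y Z :=
  g X (phi Z) *: phi Y - g Y (phi Z) *: phi X + (2 * g X (phi Y)) *: phi Z.

Definition acm_R3 X Y Z :=
  (eta X * eta Z) *: Y - (eta Y * eta Z) *: X
  + (g X Z * eta Y) *: xi - (g Y Z * eta X) *: xi.

Definition acm_R4 X Y Z :=
  g Y Z *: h X - g X Z *: h Y + g (h Y) Z *: X - g (h X) Z *: Y.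

Definition acm_R5 X Y Z :=
  g (h Y) Z *: h X - g (h X) Z *: h Y
  + g (phi (h X)) Z *: phi (h Y) - g (phi (h Y)) Z *: phi (h X).

Definition acm_R6 X Y Z :=
  (eta X * eta Z) *: h Y - (eta Y * eta Z) *: h X
  + (g (h X) Z * eta Y) *: xi - (g (h Y) Z * eta X) *: xi.

Definition generalized_kappa_mu_space_form
    (nabla : vfield M -> vfield M -> vfield M) (f1 f2 f3 f4 f5 f6 : C^oo(M)) :=
  forall X Y Z, curvature nabla X Y Z =
    f1 *: acm_R1 X Y Z + f2 *: acm_R2 X Y Z + f3 *: acm_R3 X Y Z
    + f4 *: acm_R4 X Y Z + f5 *: acm_R5 X Y Z + f6 *: acm_R6 X Y Z.

End SpaceForms.

(* Main.v *)
Require Import Defs.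
From mathcomp Require Import all_boot all_order all_algebra.
From mathcomp Require Import boolp classical_sets functions reals topology.
From mathcomp Require Import ring.

(** The identity is algebraic, term by term in the f_i: with phi skew for g,
   eta = g(-, xi) and eta o phi = 0, substituting R = sum f_i R_i makes the
   f_3 and f_6 terms vanish on the orthogonal complement of xi, and the others
   give multiples of P. *)

Import GRing.Theory.
Local Open Scope ring_scope.

(** [C^oo(M)] is not an integral domain in general, but it is reduced, because values are taken in a
    field. *)
Lemma smooth_sqr_eq0 (R : realType) (n : nat) (M : manifold R n)
    (f : C^oo(M)) : f * f = 0 -> f = 0.
Proof.
move=> ff0; apply: smooth_fun_ext => p.
have /eqP : f p * f p = 0 by exact: (congr1 (fun u : C^oo(M) => u p) ff0).
by rewrite mulf_eq0 orbb => /eqP.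
Qed.

Section Riemannian.
Context (R : realType) (n : nat) (M : manifold R n) (g : riemannian_metric M).
Implicit Types (X Y Z : vfield M) (f : C^oo(M)).

Lemma riemDl X Y Z : g (X + Y) Z = g X Z + g Y Z.
Proof. by have := riem_linear g Z 1 X Y; rewrite scale1r mul1r. Qed.

Lemma riem0l Z : g 0 Z = 0.
Proof. by apply: (addIr (g 0 Z)); rewrite -riemDl !add0r. Qed.

Lemma riemZl f X Z : g (f *: X) Z = f * g X Z.
Proof. by have := riem_linear g Z f X 0; rewrite riem0l !addr0. Qed.

Lemma riemNl X Z : g (- X) Z = - g X Z.
Proof. by rewrite -scaleN1r riemZl mulN1r. Qed.

Lemma riemNr X Z : g X (- Z) = - g X Z.
Proof. by rewrite riem_sym riemNl riem_sym. Qed.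

End Riemannian.

Definition riemE := (riemDl, riemNl, riemZl, riemNr).

Section AlmostContactMetric.
Context (R : realType) (n : nat) (M : manifold R n).
Context (S : almost_contact_metric M).
Implicit Types X Y : vfield M.

Let g := acm_g S.
Let phi := acm_phi S.
Let xi := acm_xi S.
Let eta := acm_eta S.

(** The formula for [phi^2] kills [xi]; at [phi xi] it makes [phi xi] the multiple
    [eta (phi xi) *: xi]. Applying [phi] and then [eta] to this squares the coefficient, so its
    square is 0. *)
Lemma acm_phi_xi : phi xi = 0.
Proof.
have phi2xi : phi (phi xi) = 0.
  by rewrite acm_phi2 acm_eta_xi scale1r addNr.
have phixi : phi xi = eta (phi xi) *: xi.
  apply/esym/eqP; rewrite -subr_eq0 addrC -(acm_phi2 S (phi xi)).
  by rewrite -/phi phi2xi linear0.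
have a0 : eta (phi xi) = 0.
  apply: smooth_sqr_eq0.
  have : eta (phi (phi xi)) = 0 by rewrite phi2xi linear0.
  by rewrite {1}phixi !linearZ /=.
by rewrite phixi a0 scale0r.
Qed.

(** Two computations of [phi^3 X]: [phi (phi^2 X)] is [- phi X] since [phi xi = 0], while
    [phi^2 (phi X)] has the extra term [eta (phi X) *: xi]. *)
Lemma acm_eta_phi X : eta (phi X) = 0.
Proof.
have phi3 : phi (phi (phi X)) = - phi X.
  by rewrite [phi (phi X)]acm_phi2 linearD linearN linearZ /= acm_phi_xi
             scaler0 addr0.
have : eta (phi X) *: xi = 0.
  by apply: (addrI (- phi X)); rewrite -acm_phi2 phi3 addr0.
by move/(congr1 eta); rewrite linear0 linearZ /= acm_eta_xi mulr1.
Qed.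

Lemma acm_etaE X : eta X = g X xi.
Proof.
have := acm_compatible S X xi.
rewrite -/phi acm_phi_xi riem_sym riem0l acm_eta_xi mulr1.
by move/esym/eqP; rewrite subr_eq0 => /eqP ->.
Qed.

(** Compatibility at [X] and [phi Y] gives [g (phi X) (phi^2 Y) = g X (phi Y)]; [phi^2 Y] is [- Y]
    up to a multiple of [xi], which is orthogonal to [phi X]. *)
Lemma acm_phi_skew X Y : g (phi X) Y = - g X (phi Y).
Proof.
have := acm_compatible S X (phi Y).
rewrite acm_eta_phi mulr0 subr0 -/g -/phi => <-.
rewrite acm_phi2 [in RHS]riem_sym !riemE [g (acm_xi S) _]riem_sym -acm_etaE.
by rewrite acm_eta_phi mulr0 addr0 opprK riem_sym.
Qed.

End AlmostContactMetric.

Theorem proposition3p12 (R : realType) (n : nat) (M : manifold R n)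
    (S : almost_contact_metric M)
    (nabla : vfield M -> vfield M -> vfield M)
    (nablaLC : levi_civita S nabla)
    (f1 f2 f3 f4 f5 f6 : C^oo(M))
    (SF : generalized_kappa_mu_space_form S nabla f1 f2 f3 f4 f5 f6)
    (X Y Z W : vfield M)
    (oX : acm_g S X (acm_xi S) = 0) (oY : acm_g S Y (acm_xi S) = 0)
    (oZ : acm_g S Z (acm_xi S) = 0) (oW : acm_g S W (acm_xi S) = 0) :
  curvature4 S nabla X Y Z (acm_phi S W) + curvature4 S nabla X Y (acm_phi S Z) W =
    - (f1 - f2) * acm_P S X Y Z W
    - f4 * (acm_P S (acm_h S X) Y Z W + acm_P S X (acm_h S Y) Z W)
    - 2 * f5 * acm_P S (acm_h S X) (acm_h S Y) Z W.
Proof.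
have eta0 V : acm_g S V (acm_xi S) = 0 -> acm_eta S V = 0.
  by rewrite acm_etaE.
have xi0 V : acm_eta S V = 0 -> acm_g S (acm_xi S) V = 0.
  by rewrite acm_etaE riem_sym.
have phi2 V : acm_eta S V = 0 -> acm_phi S (acm_phi S V) = - V.
  by move=> eV; rewrite acm_phi2 eV scale0r addr0.
have compat U V : acm_eta S V = 0 ->
    acm_g S (acm_phi S U) (acm_phi S V) = acm_g S U V.
  by move=> eV; rewrite acm_compatible eV mulr0 subr0.
have [[[eX eY] eZ] eW] := (eta0 X oX, eta0 Y oY, eta0 Z oZ, eta0 W oW).
rewrite /curvature4 !SF /acm_R1 /acm_R2 /acm_R3 /acm_R4 /acm_R5 /acm_R6 /acm_P.
(* The identity now holds for any two vector fields in place of [h X] and [h Y]. *)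
move: (acm_h S X) (acm_h S Y) => hX hY.
rewrite !riemE !acm_eta_phi eX eY eZ !phi2 // !riemE !compat //.
(* Normal form: [phi] occurs only once in a product and in the second slot, as in [acm_P]. The two
   terms of [acm_R2] with factor [2 * g X (phi Y)] then cancel. *)
rewrite !xi0 ?acm_eta_phi // !acm_phi_skew.
ring.
Qed.
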